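(* Let $\tau_R,\delta_R\in\mathbb{R}$ with $\delta_R>1$ and $\delta_R>\frac{\tau_R^2}{4}$, and let $\frac mp$ be the rotation number of $f$. Then $G$ is a $p$-sided polygon whose edges are subsets of $\Sigma_0,\Sigma_1,\ldots,\Sigma_{p-1}$ (one edge $T_j\subset\Sigma_j$ for each $j=0,1,\ldots,p-1$), ordered clockwise, starting from the edge on $\Sigma_0$, by the rotation permutation $\mathcal{P}_{m,p}$ (i.e. going clockwise from $T_0$ the edges are $T_{\mathcal{P}_{m,p}(0)},T_{\mathcal{P}_{m,p}(1)},\ldots,T_{\mathcal{P}_{m,p}(p-1)}$). Moreover, $G=f_R^{p-1}(F_p)$.
   Context: For real parameters $\tau_L,\tau_R,\delta_R$ ($\tau_L$ arbitrary) define $f:\mathbb{R}^2\to\mathbb{R}^2$ by $f(x,y)=(\tau_L x+y+1,\,0)$ if $x\le 0$ and $f(x,y)=f_R(x,y)$ if $x\ge0$, where $f_R(x,y)=(\tau_R x+y+1,\,-\delta_R x)$ on all of $\mathbb{R}^2$. Let $\Omega_R=\{(x,y):x>0\}$ and $\Sigma_0=\{(x,y):x=0\}$. For $r\ge0$ let $\Sigma_r=f_R^r(\Sigma_0)$ (so $\Sigma_1$ is the $x$-axis). For $r\ge1$ let $F_r=\{P\in\mathbb{R}^2: f_R^j(P)\in\Omega_R\text{ for all }j=0,1,\ldots,r-1\}$, and let $$G=\{P\in\mathbb{R}^2: f_R^{-j}(P)\in\Omega_R\text{ for all }j\ge0\}.$$ An open set is called a polygon if it is the interior of a polygon; its edges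 are those of its closure. For irreducible $\frac mp\in(0,1)$, the rotation permutation $\mathcal{P}_{m,p}$ is the permutation of $\mathbb{Z}_p=\{0,1,\ldots,p-1\}$ defined by $\mathcal{P}_{m,p}(im\bmod p)=i$ for $i=0,1,\ldots,p-1$. Rotation number. For $x\in\mathbb{R}$ let $N(x)$ be the smallest $n\ge1$ for which the second component of $f^n(x,0)$ is $0$, if it exists; let $I_n=\{x\in(-\infty,1]:N(x)=n\}$ and $n^*=N(1)$. A fraction $\frac mp$ is irreducible if $m,p$ are integers with no common factors and $p\ge1$. For irreducible $\frac mp\in(0,1)$, its left and right parents are the unique irreducible fractions $\frac{m^-}{p^-}<\frac{m^+}{p^+}$ in $[0,1]$ with $m^+p^--m^-p^+=1$, $m^-+m^+=m$, $p^-+p^+=p$. For irreducible $\frac mp\in(0,\frac1{n^*})$, let $\frac{m_1^-}{p_1^-}$ be the left parent of $\frac mp$, $\frac{m_2^-}{p_2^-}$ the left parent of that, and so on until $\frac{m_s^-}{p_s^-}=\frac01$; let $\frac{m_1^+}{p_1^+}$ be the right parent of $\frac mp$, $\frac{m_2^+}{p_2^+}$ the right parent of that, and so on until $\frac{m_t^+}{p_t^+}=\frac1{n^*}$; then $D[m,p;n^*]=(p_s^-,\ldots,p_1^-,p,p_1^+,\ldots,p_t^+)$. The rotation number of $f$ is the unique irreducible fraction $\frac mp\in\left[\frac1{n^*+1},\frac1{n^*}\right)$ such that for all $n\ge1$, $I_n\neq\varnothing$ if and only if $n\in D[m,p;n^*]$, with the non-empty $I_n$ covering $(-\infty,1]$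 and ordered from left to right by $D[m,p;n^*]$ (existence, uniqueness and independence of $\tau_L$ hold under the stated hypotheses). *)

(* Defs.v *)
From mathcomp Require Import all_boot all_order all_algebra.
From mathcomp Require Import all_classical all_reals all_analysis.
From mathcomp Require Import ring.

Set Implicit Arguments.
Unset Strict Implicit.
Unset Printing Implicit Defensive.

Import Order.TTheory GRing.Theory Num.Theory.
Import numFieldNormedType.Exports.

Local Open Scope classical_set_scope.
Local Open Scope ring_scope.

(** * The maps *)

Section Maps.
Context {R : realType}.
Implicit Types (tauL tauR deltaR : R) (P : R * R).

Definition fR tauR deltaR P : R * R :=
  (tauR * P.1 + P.2 + 1, - deltaR * P.1).

Definition fL tauL P : R * R := (tauL * P.1 + P.2 + 1, 0).

(* The two pieces agree on the line x = 0. *)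
Definition f tauL tauR deltaR P : R * R :=
  if P.1 <= 0 then fL tauL P else fR tauR deltaR P.

(* The inverse of [fR] when [deltaR != 0], see [fRK] and [fRinvK]. *)
Definition fRinv tauR deltaR P : R * R :=
  (- P.2 / deltaR, P.1 - 1 + tauR * P.2 / deltaR).

Lemma fRK tauR deltaR : deltaR != 0 ->
  cancel (fR tauR deltaR) (fRinv tauR deltaR).
Proof. by move=> d0 [x y]; rewrite /fR /fRinv /=; congr pair; field. Qed.

Lemma fRinvK tauR deltaR : deltaR != 0 ->
  cancel (fRinv tauR deltaR) (fR tauR deltaR).
Proof. by move=> d0 [x y]; rewrite /fR /fRinv /=; congr pair; field. Qed.

Definition OmegaR : set (R * R) := [set P | 0 < P.1].

Definition Sigma0 : set (R * R) := [set P | P.1 = 0].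

Definition Sigma tauR deltaR (r : nat) : set (R * R) :=
  iter r (fR tauR deltaR) @` Sigma0.

Definition F tauR deltaR (r : nat) : set (R * R) :=
  [set P | forall j, (j < r)%N -> OmegaR (iter j (fR tauR deltaR) P)].

Definition G tauR deltaR : set (R * R) :=
  [set P | forall j, OmegaR (iter j (fRinv tauR deltaR) P)].

End Maps.

(** * Farey parents and rotation number *)

Definition frac (m p : nat) : rat := m%:R / p%:R.

(* Fractions below all lie in [0, 1], so natural numerators suffice. *)
Definition irreducible_frac (m p : nat) : bool := (0 < p)%N && coprime m p.

(* mm/pm and mp/pp are the left and right parents of m/p. *)
Definition parents (m p mm pm mp pp : nat) : Prop :=
  [/\ [&& irreducible_frac m p, 0 < frac m p & frac m p < 1],
      irreducible_frac mm pm && irreducible_frac mp pp,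
      [&& 0 <= frac mm pm, frac mm pm < frac mp pp & frac mp pp <= 1],
      (mp * pm = mm * pp + 1)%N
    & (mm + mp = m)%N /\ (pm + pp = p)%N].

(* [left_chain m p s]: s = [:: p_1^-; ...; p_s^-] are the denominators of the
   iterated left parents of m/p, stopping at 0/1. *)
Inductive left_chain : nat -> nat -> seq nat -> Prop :=
| left_chain_stop : left_chain 0 1 [::]
| left_chain_step m p mm pm mp pp s :
    parents m p mm pm mp pp -> left_chain mm pm s ->
    left_chain m p (pm :: s).

(* Same for the iterated right parents [:: p_1^+; ...; p_t^+], stopping at
   1/n. *)
Inductive right_chain (n : nat) : nat -> nat -> seq nat -> Prop :=
| right_chain_stop : right_chain n 1 n [::]
| right_chain_step m p mm pm mp pp s :
    (m, p) <> (1, n)%N ->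
    parents m p mm pm mp pp -> right_chain n mp pp s ->
    right_chain n m p (pp :: s).

(* [is_D m p n d]: d is the sequence D[m, p; n]. *)
Definition is_D (m p n : nat) (d : seq nat) : Prop :=
  exists sl sr, [/\ left_chain m p sl, right_chain n m p sr
                  & d = rev sl ++ p :: sr].

Section RotationNumber.
Context {R : realType}.
Implicit Types (tauL tauR deltaR x : R).

(* [is_N tauL tauR deltaR x n]: N(x) exists and equals n. *)
Definition is_N tauL tauR deltaR x (n : nat) : Prop :=
  [/\ (1 <= n)%N, (iter n (f tauL tauR deltaR) (x, 0)).2 = 0
    & forall k, (1 <= k < n)%N -> (iter k (f tauL tauR deltaR) (x, 0)).2 != 0].

Definition I_ tauL tauR deltaR (n : nat) : set R :=
  [set x | x <= 1 /\ is_N tauL tauR deltaR x n].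

Definition is_rotation_number tauL tauR deltaR (m p : nat) : Prop :=
  irreducible_frac m p /\
  exists nstar d,
    [/\ is_N tauL tauR deltaR 1 nstar,
        frac 1 nstar.+1 <= frac m p < frac 1 nstar,
        is_D m p nstar d,
        forall n, (1 <= n)%N -> (I_ tauL tauR deltaR n !=set0 <-> n \in d)
      & (forall x, x <= 1 -> exists n, I_ tauL tauR deltaR n x) /\
        (forall i j, (i < j < size d)%N ->
           forall x y, I_ tauL tauR deltaR (nth 0%N d i) x ->
                       I_ tauL tauR deltaR (nth 0%N d j) y -> x < y)].

End RotationNumber.

(** * Rotation permutation *)

(* The i with i m = k mod p; the default of [odflt] is never used when m and p
   are coprime, see [rotation_permE]. *)
Definition rotation_perm (m p : nat) (k : 'I_p) : 'I_p :=
  odflt k [pick i : 'I_p | (i * m) %% p == k]%N.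

Lemma rotation_permE (m p : nat) (i k : 'I_p) : coprime m p ->
  ((i * m) %% p = k)%N -> rotation_perm m k = i.
Proof.
move=> mp ik; rewrite /rotation_perm; case: pickP => [j /eqP jk|/(_ i)] /=;
  last by rewrite ik eqxx.
apply/val_inj => /=; move: (ltn_ord i) (ltn_ord j) => lip ljp.
have : (i * m == j * m %[mod p])%N by rewrite ik jk.
wlog ij : i j lip ljp {ik jk} / (i <= j)%N => [wl|].
  case: (leqP i j) => [|/ltnW] ij; first exact: (wl i j).
  by rewrite eq_sym => h; apply/esym/(wl j i).
rewrite eq_sym eqn_mod_dvd ?leq_mul2r ?ij ?orbT // -mulnBl Gauss_dvdl;
  last by rewrite coprime_sym.
rewrite -eqn_mod_dvd // !modn_small // => /eqP; exact.
Qed.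

Lemma rotation_perm_bij (m p : nat) : coprime m p ->
  bijective (@rotation_perm m p).
Proof.
case: p => [|p] mp; first by exists id => -[].
pose g (i : 'I_p.+1) := Ordinal (ltn_pmod (i * m) (ltn0Sn p)).
have gK : cancel g (@rotation_perm m p.+1) by move=> i; exact: rotation_permE.
by apply: (@bij_can_bij _ _ g) => //; exact: injF_bij (can_inj gK).
Qed.

(** * Polygons *)

Section Polygons.
Context {R : realType}.
Implicit Types (a b : R * R).

Definition cross a b : R := a.1 * b.2 - a.2 * b.1.

Definition segment a b : set (R * R) :=
  [set (1 - t) *: a + t *: b | t in `[0, 1]].

Context {p : nat} (v : 'I_p -> R * R).

(* [ordS] is the cyclic successor on 'I_p, so [edge i] joins the i-th vertex to
   the next one and the last edge closes up the chain. *)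
Definition edge (i : 'I_p) : set (R * R) := segment (v i) (v (ordS i)).

Definition boundary : set (R * R) := \bigcup_(i in [set: 'I_p]) edge i.

(* The chain is a simple closed curve with exactly p sides: consecutive edges
   are not collinear and meet only at the common vertex, all other pairs of
   edges are disjoint. *)
Definition simple_polygon : Prop :=
  [/\ (3 <= p)%N,
      forall i, cross (v (ordS i) - v i) (v (ordS (ordS i)) - v (ordS i)) != 0,
      forall i, edge i `&` edge (ordS i) = [set v (ordS i)]
    & forall i j, i != j -> j != ordS i -> i != ordS j ->
        edge i `&` edge j = set0].

(* The closed region bounded by the chain: the chain and the bounded connected
   components of its complement. *)
Definition polygon_region : set (R * R) :=
  boundary `|` [set P | (~` boundary) P /\
                        bounded_set (connected_component (~` boundary) P)].

(* [U] is an open polygon with vertices [v 0], ..., [v p.-1]. *)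
Definition open_polygon (U : set (R * R)) : Prop :=
  simple_polygon /\ U = interior polygon_region.

Definition signed_area : R := 2^-1 * \sum_(i < p) cross (v i) (v (ordS i)).

Definition clockwise : Prop := signed_area < 0.

End Polygons.

(* Main.v *)
(* The abscissas of the two-sided orbit of a point P under f_R form a sequence
   (x_n), n in Z, with x_(n+1) = t x_n - d x_(n-1) + 1, and P lies in G iff
   x_(-j) > 0 for all j >= 0, on Sigma_j iff x_(-j) = 0. A sequence with x_0 = 0
   is the shifted orbit of a point (s, 0), and N(s) is the first n >= 1 with
   x_n <= 0. As p is the largest element of D, no sequence vanishes at a term
   followed by p positive ones; moving towards the constant sequence then shows
   that p consecutive positive terms are preceded by positive terms only, so
   that p half-planes suffice to cut out G. The ends of the interval I_p, next
   to I_(p^-) and I_(p^+), give sequences vanishing at {0, p^-} and at {0, p^+}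
   and nonnegative up to p; an interior point of I_p gives one vanishing only at
   0, which forbids three zeros within p consecutive terms. The translates of
   the two corner sequences are therefore the vertices of a strictly convex
   p-gon whose edge on Sigma_j is followed by the one on Sigma_(j + p^-) or
   Sigma_(j - p^+); these are the steps of the rotation permutation because
   m p^- = 1 mod p. *)
Require Import Defs.
From mathcomp Require Import all_boot all_order all_algebra.
From mathcomp Require Import all_classical all_reals all_analysis.
From mathcomp Require Import ring lra zify.
Import Order.TTheory GRing.Theory Num.Theory.
Import numFieldNormedType.Exports.
Local Open Scope classical_set_scope.
Local Open Scope ring_scope.

(** * Polygons cut out by half-planes *)

Section ConvexPolygon.
Context {R : realType} {p : nat} (v : 'I_p -> R * R) (a b c : 'I_p -> R).
Context (C : R * R).
Implicit Types (P Q : R * R) (i j k : 'I_p) (s : R).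

Definition side i P : R := a i * P.1 + b i * P.2 + c i.

Context (p3 : (3 <= p)%N).
Context (side0 : forall i, side i (v i) = 0).
Context (sideS : forall i, side i (v (ordS i)) = 0).
Context (side_gt0 : forall i k, k != i -> k != ordS i -> 0 < side i (v k)).
Context (side_center : forall i, 0 < side i C).
Context (side_bounded : bounded_set [set P | forall i, 0 < side i P]).

Let K : set (R * R) := [set P | forall i, 0 <= side i P].
Let U : set (R * R) := [set P | forall i, 0 < side i P].

Lemma side_comb i P Q s :
  side i ((1 - s) *: P + s *: Q) = (1 - s) * side i P + s * side i Q.
Proof. by rewrite /side /= /GRing.scale /=; ring. Qed.

Lemma side_ray i P s : side i (P + s *: (P - C)) = (1 + s) * side i P - s * side i C.
Proof. by rewrite /side /= /GRing.scale /=; ring. Qed.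

Lemma continuous_side i : continuous (side i).
Proof.
move=> P; apply: cvgD; last exact: cvg_cst.
by apply: cvgD; apply: cvgM;
  [exact: cvg_cst|exact: cvg_fst|exact: cvg_cst|exact: cvg_snd].
Qed.

Lemma ordS_neq i : ordS i != i.
Proof.
apply/negP => /eqP/(congr1 val) /=; have ip := ltn_ord i.
have [e|lt] := eqVneq i.+1 p; first by rewrite e modnn; lia.
by rewrite modn_small; lia.
Qed.

Lemma ordSS_neq i : ordS (ordS i) != i.
Proof.
apply/negP => /eqP/(congr1 val) /=; have ip := ltn_ord i.
have [e|lt] := eqVneq i.+1 p; first by rewrite e modnn modn_small; lia.
rewrite (@modn_small i.+1); last lia.
have [e|lt'] := eqVneq i.+2 p; first by rewrite e modnn; lia.
by rewrite modn_small; lia.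
Qed.

Lemma side_vS i : 0 < side (ordS i) (v i).
Proof. by apply: side_gt0; rewrite eq_sym ?ordS_neq ?ordSS_neq. Qed.

Lemma side_v_ge0 i k : 0 <= side i (v k).
Proof.
have [->|ki] := eqVneq k i; first by rewrite side0.
by have [->|kS] := eqVneq k (ordS i); rewrite ?sideS // ltW // side_gt0.
Qed.

Lemma side_edge i P : edge v i P -> side i P = 0.
Proof. by case=> s _ <-; rewrite side_comb side0 sideS !mulr0 addr0. Qed.

Lemma edge_sub i : edge v i `<=` K.
Proof.
move=> P [s /=]; rewrite in_itv /= => /andP[s0 s1] <- j; rewrite side_comb.
by rewrite addr_ge0 // mulr_ge0 ?side_v_ge0 ?subr_ge0.
Qed.

Lemma vS_neq i : v i != v (ordS i).
Proof.
apply/eqP => e; have := side_vS i.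
by rewrite e side0 ltxx.
Qed.

(** The form [side i] vanishes at [v i] but not at [C], so its linear part is nonzero and its zeros
    form the line through the distinct points [v i] and [v (ordS i)]. *)
Lemma side_line i P : side i P = 0 ->
  exists s, P = (1 - s) *: v i + s *: v (ordS i).
Proof.
move=> Pi; have v0 := side0 i; have v1 := sideS i; have Ci := side_center i.
have := vS_neq i.
case: P Pi (v i) v0 (v (ordS i)) v1 => [u1 u2] hu [x1 x2] hx [y1 y2] hy xy.
move: hu hx hy; rewrite /side /= => hu hx hy.
pose r1 := u1 - x1; pose r2 := u2 - x2; pose e1 := y1 - x1; pose e2 := y2 - x2.
have hr : a i * r1 + b i * r2 = 0 by rewrite /r1 /r2; lra.
have he : a i * e1 + b i * e2 = 0 by rewrite /e1 /e2; lra.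
have re : r1 * e2 - r2 * e1 = 0.
  have ha : a i * (r1 * e2 - r2 * e1) = 0.
    by transitivity ((a i * r1 + b i * r2) * e2 - r2 * (a i * e1 + b i * e2));
      [ring|rewrite hr he; ring].
  have hb : b i * (r1 * e2 - r2 * e1) = 0.
    by transitivity (r1 * (a i * e1 + b i * e2) - e1 * (a i * r1 + b i * r2));
      [ring|rewrite hr he; ring].
  have [ai|ai] := eqVneq (a i) 0; last by apply: (mulfI ai); rewrite ha mulr0.
  have [bi|bi] := eqVneq (b i) 0; last by apply: (mulfI bi); rewrite hb mulr0.
  by move: Ci hx; rewrite /side ai bi !mul0r !add0r => c0 c1; rewrite c1 ltxx in c0.
have ee : e1 ^+ 2 + e2 ^+ 2 != 0.
  apply: contra xy; rewrite paddr_eq0 ?sqr_ge0 // !sqrf_eq0 !subr_eq0.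
  by move=> /andP[/eqP-> /eqP->].
(* Parameter of the orthogonal projection onto the edge direction. *)
exists ((r1 * e1 + r2 * e2) / (e1 ^+ 2 + e2 ^+ 2)); set s := _ / _.
have se : s * (e1 ^+ 2 + e2 ^+ 2) = r1 * e1 + r2 * e2 by rewrite divfK.
have E1 : r1 = s * e1.
  apply: (mulIf ee); rewrite mulrAC se.
  by apply/subr0_eq; transitivity ((r1 * e2 - r2 * e1) * e2);
    [ring|rewrite re mul0r].
have E2 : r2 = s * e2.
  apply: (mulIf ee); rewrite mulrAC se.
  by apply/subr0_eq; transitivity (- (r1 * e2 - r2 * e1) * e1);
    [ring|rewrite re oppr0 mul0r].
clearbody s; transitivity (x1 + r1, x2 + r2).
  by rewrite /r1 /r2 !subrKC.
by rewrite E1 E2; congr pair; rewrite /e1 /e2 /GRing.scale /= /GRing.scale /=; ring.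
Qed.

Lemma edgeE i : edge v i = [set P | K P /\ side i P = 0].
Proof.
apply/seteqP; split=> [P Pi|P [PK Pi]].
  by split; [exact: edge_sub Pi|exact: side_edge].
have [s Ps] := side_line i P Pi.
exists s => //=; rewrite in_itv /=.
(* On the line of side [i], the preceding side is a positive multiple of [s] and the following one a
   positive multiple of [1 - s], which confines [s] to the unit interval. *)
have [j ji] : exists j, ordS j = i by exists (ord_pred i); exact: ord_predK.
subst i.
have := PK j; have := PK (ordS (ordS j)).
rewrite Ps !side_comb side0 sideS !mulr0 add0r addr0.
rewrite pmulr_lge0 ?side_vS // subr_ge0 => -> /=.
by rewrite pmulr_lge0 ?andbT // side_gt0 ?ordSS_neq ?ordS_neq.
Qed.

Lemma boundaryE : boundary v = K `\` U.
Proof.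
apply/seteqP; split=> [P [i _]|P [PK PU]].
  by rewrite edgeE => -[PK Pi]; split=> // /(_ i); rewrite Pi ltxx.
have [i Pi] : exists i, side i P = 0.
  apply: contrapT => /forallNP h; apply: PU => i.
  by rewrite lt_neqAle PK andbT eq_sym; apply/eqP/h.
by exists i => //; rewrite edgeE.
Qed.

Lemma open_U : open U.
Proof.
have -> : U = ~` \bigcup_(i in [set: 'I_p]) [set P | side i P <= 0].
  apply/seteqP; split=> P /=.
    by move=> PU [i _ /=]; rewrite leNgt PU.
  by move=> h i; rewrite ltNge; apply/negP => Pi; apply: h; exists i.
apply: closed_openC; apply: closed_bigcup => [|i _]; first exact: finite_finset.
exact: ((continuous_closedP _).1 (continuous_side i) _ (@closed_le R 0)).
Qed.

Lemma closed_K : closed K.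
Proof.
have -> : K = \bigcap_(i in [set: 'I_p]) [set P | 0 <= side i P].
  by apply/seteqP; split=> P /= h i; [move=> _; exact: h|exact: (h i)].
apply: closed_bigI => i _.
exact: ((continuous_closedP _).1 (continuous_side i) _ (@closed_ge R 0)).
Qed.

Lemma U_sub_K : U `<=` K.
Proof. by move=> P PU i; apply: ltW. Qed.

(** Off the boundary, the open set [U] and the closed set [K] have the same points, so [U] cuts a
    clopen part out of the component. *)
Lemma component_sub_U P : U P -> connected_component (~` boundary v) P `<=` U.
Proof.
move=> PU; set A := connected_component _ _.
have Asub : A `<=` ~` boundary v by exact: connected_component_sub.
have AP : A P.
  by apply: connected_component_refl; rewrite boundaryE => -[_]; apply.
have AU : A `&` U = A.
  apply: (@component_connected _ (~` boundary v) P).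
  - by exists P.
  - by exists U => //; exact: open_U.
  - exists K; first exact: closed_K.
    apply/seteqP; split=> Q [AQ QU]; split=> //; first exact: U_sub_K.
    apply: contrapT => nQU; apply: (Asub Q AQ).
    by rewrite boundaryE.
by rewrite -AU => Q [].
Qed.

Let ray P : R -> R * R := fun s => P + s *: (P - C).

Lemma continuous_ray P : continuous (ray P).
Proof.
move=> s; apply: cvgD; first exact: cvg_cst.
by apply: cvgZ; [exact: cvg_id|exact: cvg_cst].
Qed.

(** Since [C] is strictly inside, a side that is nonpositive at [P] decreases along the ray from [P]
    away from [C]. *)
Lemma ray_notK P s i : side i P <= 0 -> 0 <= s -> (side i P < 0) || (0 < s) ->
  ~ K (ray P s).
Proof.
move=> Pi s0 H /(_ i); rewrite side_ray; have Ci := side_center i.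
by case/orP: H => H; nra.
Qed.

(** The whole ray from [P] away from [C] misses [K], hence the boundary, and so lies in the
    component of [P]. *)
Lemma unbounded_component P : ~ K P ->
  ~ bounded_set (connected_component (~` boundary v) P).
Proof.
move=> PK bnd.
have [i Pi] : exists i, side i P < 0.
  apply: contrapT => /forallNP h; apply: PK => i.
  by rewrite leNgt; apply/negP/h.
have PC : 0 < `|P - C|.
  rewrite normr_gt0 subr_eq0; apply/eqP => e.
  by have := side_center i; rewrite -e; lra.
have sub : ray P @` `[0, +oo[ `<=` connected_component (~` boundary v) P.
  apply: connected_component_max.
  - by exists 0; [rewrite /= in_itv /= lexx|rewrite /ray scale0r addr0].
  - move=> Q [s /=]; rewrite in_itv /= andbT => s0 <-.
    rewrite boundaryE => -[+ _].
    by apply: (ray_notK _ _ i) => //; rewrite ?Pi // ltW.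
  - apply: connected_continuous_connected.
      exact/connected_intervalP/interval_is_interval.
    exact/continuous_subspaceT/continuous_ray.
have /ex_strict_bound_gt0[M M0 hM] := bnd.
(* The displacement from [P] then has length [M] plus the norm of [P], so the point reached has norm
   at least [M]. *)
pose s := (M + `|P|) / `|P - C|.
have s0 : 0 <= s by rewrite divr_ge0 // addr_ge0 // ltW.
have := hM (ray P s) (sub _ _); rewrite /= ltNge => /(_ _)/negP; apply.
  by exists s => //=; rewrite in_itv /= s0.
have : `|s *: (P - C)| <= `|ray P s| + `|P|.
  by rewrite -{1}(addKr P (s *: _)) addrC (le_trans (ler_normB _ _)).
by rewrite normrZ ger0_norm // divfK ?gt_eqF // lerD2r.
Qed.

Lemma regionE : polygon_region v = K.
Proof.
apply/seteqP; split=> P.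
  case=> [|[_ bnd]]; first by rewrite boundaryE => -[].
  by apply: contrapT => /unbounded_component.
move=> PK; have [PU|PU] := pselect (U P); last by left; rewrite boundaryE.
right; split; first by rewrite boundaryE => -[].
have [M [Mreal hM]] := side_bounded; exists M; split=> // M' MM' Q.
by move=> /(component_sub_U P PU)/(hM M' MM').
Qed.

Lemma interiorK : interior K = U.
Proof.
apply/seteqP; split=> [P PK i|]; last first.
  by rewrite -open_subsetE; [exact: U_sub_K|exact: open_U].
rewrite ltNge; apply/negP => Pi.
(* An interior point keeps a short piece of its ray inside [K], but here any positive step leaves
   [K]. *)
have : \forall s \near 0, K (ray P s).
  have ray0 : ray P 0 = P by rewrite /ray scale0r addr0.
  by apply: (continuous_ray P 0); rewrite /= ray0; exact: PK.
move=> /nbhs_ballP[e /= e0 He].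
have := He (e / 2); rewrite /ball /= sub0r normrN gtr0_norm ?divr_gt0 //.
have e20 : 0 < e / 2 by rewrite divr_gt0.
rewrite ltr_pdivrMr // mulr_natr mulr2n ltrDl => /(_ e0).
by apply: (ray_notK _ _ i) => //; [exact: ltW|rewrite e20 orbT].
Qed.

(** If the cross product vanished, [P] would lie on the line through [v i] and [v (ordS i)], where
    [side i] is zero. *)
Lemma cross_neq0 i P : side i P != 0 ->
  cross (v (ordS i) - v i) (P - v (ordS i)) != 0.
Proof.
apply: contra => /eqP cr; apply/eqP.
have := vS_neq i; have := side0 i; have := sideS i; move: cr.
case: P (v i) (v (ordS i)) => [u1 u2] [x1 x2] [y1 y2].
rewrite /cross /side /= => cr hy hx xy.
have h1 : (y1 - x1) * (a i * u1 + b i * u2 + c i) = 0.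
  transitivity ((y1 - x1) * (a i * y1 + b i * y2 + c i)
    + b i * ((y1 - x1) * (u2 - y2) - (y2 - x2) * (u1 - y1))
    + (u1 - y1) * ((a i * y1 + b i * y2 + c i) - (a i * x1 + b i * x2 + c i))).
    by ring.
  by rewrite hx hy cr; ring.
have h2 : (y2 - x2) * (a i * u1 + b i * u2 + c i) = 0.
  transitivity ((y2 - x2) * (a i * y1 + b i * y2 + c i)
    - a i * ((y1 - x1) * (u2 - y2) - (y2 - x2) * (u1 - y1))
    + (u2 - y2) * ((a i * y1 + b i * y2 + c i) - (a i * x1 + b i * x2 + c i))).
    by ring.
  by rewrite hx hy cr; ring.
have [e1|e1] := eqVneq (y1 - x1) 0; last by apply: (mulfI e1); rewrite h1 mulr0.
have [e2|e2] := eqVneq (y2 - x2) 0; last by apply: (mulfI e2); rewrite h2 mulr0.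
by move: xy; rewrite (subr0_eq e1) (subr0_eq e2) eqxx.
Qed.

Lemma convex_simple_polygon : simple_polygon v.
Proof.
split=> //.
- move=> i; apply: cross_neq0; rewrite gt_eqF // side_gt0 ?ordSS_neq //.
  exact: ordS_neq.
- move=> i; apply/seteqP; split=> [P [[s _ <-] /side_edge]|_ ->].
    rewrite side_comb side0 mulr0 addr0 => /eqP; rewrite mulf_eq0.
    rewrite (gt_eqF (side_vS i)) orbF subr_eq0 => /eqP <-.
    by rewrite subrr scale0r scale1r add0r.
  rewrite !edgeE; split; split; rewrite ?sideS ?side0 //; move=> j; exact: side_v_ge0.
- move=> i j ij jS iS; apply/seteqP; split=> // P [[s /=]].
  rewrite in_itv /= => /andP[s0 s1] <- /side_edge.
  have h0 : 0 < side j (v i) by exact: side_gt0.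
  have h1 : 0 < side j (v (ordS i)).
    by apply: side_gt0; [rewrite eq_sym|rewrite (inj_eq (@ordS_inj p))].
  by rewrite side_comb; nra.
Qed.

Lemma convex_open_polygon : open_polygon v U.
Proof. by split; [exact: convex_simple_polygon|rewrite regionE interiorK]. Qed.

Lemma clockwise_center :
  (forall i, cross (v i - C) (v (ordS i) - C) < 0) -> clockwise v.
Proof.
move=> neg; rewrite /clockwise /signed_area pmulr_rlt0 ?invr_gt0 //.
(* Moving the origin to [C] changes each term by a difference that telescopes around the cycle. *)
have -> : \sum_i cross (v i) (v (ordS i)) = \sum_i cross (v i - C) (v (ordS i) - C).
  have E i : cross (v i - C) (v (ordS i) - C) =
      cross (v i) (v (ordS i)) + (cross C (v i) - cross C (v (ordS i))).
    by rewrite /cross /=; ring.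
  rewrite [RHS](eq_bigr _ (fun i _ => E i)) -[LHS]addr0.
  rewrite -[X in _ + X](subrr (\sum_i cross C (v i))).
  rewrite [X in _ - X](reindex_inj (@ordS_inj p)) -sumrB -big_split.
  by apply: eq_bigr.
have i0 : 'I_p by exact: (Ordinal (leq_trans (ltn0Sn 2) p3)).
rewrite (bigD1 i0) //= ltr_nwDl //.
by apply: sumr_le0 => i _; exact: ltW.
Qed.

End ConvexPolygon.

(** * Farey parents and the rotation permutation *)

Lemma parents_denominators m p mm pm mp pp : parents m p mm pm mp pp ->
  [/\ (0 < pm)%N, (0 < pp)%N, (pm + pp = p)%N & (m * pm = mm * p + 1)%N].
Proof.
case=> _ /andP[/andP[pm0 _] /andP[pp0 _]] _ e [<- <-]; split=> //.
by rewrite mulnDl e mulnDr addnA.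
Qed.

Lemma left_chain_denominators m p s : left_chain m p s ->
  forall q, q \in s -> (0 < q < p)%N.
Proof.
elim=> {m p s} // m p mm pm mp pp s /parents_denominators[pm0 pp0 e _] _ IH q.
by rewrite inE => /orP[/eqP->|/IH]; lia.
Qed.

Lemma right_chain_denominators n m p s : right_chain n m p s ->
  forall q, q \in s -> (0 < q < p)%N.
Proof.
elim=> {m p s} // m p mm pm mp pp s _ /parents_denominators[pm0 pp0 e _] _ IH q.
by rewrite inE => /orP[/eqP->|/IH]; lia.
Qed.

(** The strict bounds on the fraction keep both chains from being empty, so [p] has a neighbour in
    [d] on each side. *)
Lemma is_D_parents m p n d : is_D m p n d -> 0 < Defs.frac m p < Defs.frac 1 n ->
  exists q1 q2 e1 e2, [/\ d = e1 ++ [:: q1, p, q2 & e2],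
    (0 < q1)%N && (0 < q2)%N, (q1 + q2 = p)%N,
    exists k, (m * q1 = k * p + 1)%N & forall q, q \in d -> (q <= p)%N].
Proof.
move=> [sl [sr [hl hr ->]]] /andP[f0 f1].
have ltl := left_chain_denominators _ _ _ hl.
have ltr := right_chain_denominators _ _ _ _ hr.
case: hl f0 f1 hr ltl ltr => {m p sl} [|m p mm pm mp pp sl par _ f0 f1 hr].
  by rewrite /Defs.frac mul0r ltxx.
case: hr f0 f1 par => {m p sr} [|m p mm' pm' mp' pp' sr _ par' _ _ _ par ltl ltr].
  by rewrite ltxx.
have [pm0 pp0 e em] := parents_denominators _ _ _ _ _ _ par.
have [pm0' pp0' e' em'] := parents_denominators _ _ _ _ _ _ par'.
have cop : coprime m p by case: par => /and3P[/andP[_ ->]].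
(* Each chain comes with its own pair of parents; both left denominators invert [m] modulo [p] and
   lie strictly between 0 and [p], so they agree. *)
have pmE : pm = pm'.
  suff /eqP : (pm == pm' %[mod p])%N by rewrite !modn_small //; lia.
  have : (m * pm == m * pm' %[mod p])%N by rewrite em em' !modnMDl.
  have [le|/ltnW le] := leqP pm' pm.
    by rewrite !eqn_mod_dvd ?leq_mul2l ?le ?orbT // -mulnBr Gauss_dvdr // coprime_sym.
  rewrite eq_sym => h; rewrite eq_sym; move: h.
  by rewrite !eqn_mod_dvd ?leq_mul2l ?le ?orbT // -mulnBr Gauss_dvdr // coprime_sym.
exists pm, pp', (rev sl), sr; split.
- by rewrite rev_cons cat_rcons.
- by rewrite pm0 pp0'.
- by rewrite pmE.
- by exists mm.
move=> q; rewrite mem_cat mem_rev inE => /orP[/ltl|/orP[/eqP->//|/ltr]]; lia.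
Qed.

(** A left inverse of multiplication by [m] modulo [p] that is bijective is also a right inverse. *)
Lemma rotation_perm_mod m p (i : 'I_p) : coprime m p ->
  ((rotation_perm m i * m) %% p = i)%N.
Proof.
move=> cop; have p0 : (0 < p)%N := leq_ltn_trans (leq0n i) (ltn_ord i).
pose g (j : 'I_p) := Ordinal (ltn_pmod (j * m) p0).
rewrite -[LHS]/(val (g (rotation_perm m i))); congr val.
by apply: (bij_inj (rotation_perm_bij cop)); exact: rotation_permE.
Qed.

(** Addition of [q1] modulo [q1 + q2], on representatives below the modulus. *)
Definition next_edge (q1 q2 j : nat) :=
  if (j < q2)%N then (j + q1)%N else (j - q2)%N.

(** As [m * q1] is 1 modulo [p], adding [q1] to an index adds 1 to its product with [m]. *)
Lemma rotation_perm_ordS m p q1 q2 k (i : 'I_p) : coprime m p ->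
  (q1 + q2 = p)%N -> (m * q1 = k * p + 1)%N ->
  rotation_perm m (ordS i) = next_edge q1 q2 (rotation_perm m i) :> nat.
Proof.
move=> cop q12 mq1; have ri := ltn_ord (rotation_perm m i).
have np : (next_edge q1 q2 (rotation_perm m i) < p)%N.
  by rewrite /next_edge; case: ifP; lia.
rewrite (rotation_permE (i := Ordinal np) cop) //= /next_edge.
have e : ((rotation_perm m i + q1) * m = i.+1 %[mod p])%N.
  rewrite mulnDl -modnDml (rotation_perm_mod _ _ _ cop) mulnC mq1 addnCA.
  by rewrite modnMDl addn1.
case: ltnP => // q2i; rewrite -e.
have -> : (rotation_perm m i + q1 = rotation_perm m i - q2 + p)%N by lia.
by rewrite mulnDl mulnC (mulnC p) addnC modnMDl.
Qed.

Lemma iterK_sub (T : Type) (g h : T -> T) (i n : nat) x : cancel g h ->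
  (i <= n)%N -> iter i h (iter n g x) = iter (n - i) g x.
Proof.
move=> gK; elim: i => [|i IH] le; first by rewrite subn0.
by rewrite iterS IH ?(ltnW le) // -subSS subSn // iterS gK.
Qed.

(** * Two-sided orbits *)

Section Recurrence.
Context {R : realType} (t d : R) (d1 : 1 < d) (td : t ^+ 2 / 4 < d).
Implicit Types (x y h : int -> R) (a b k n : int) (s : R).

Definition affrec x := forall n, x (n + 1) = t * x n - d * x (n - 1) + 1.
Definition homrec h := forall n, h (n + 1) = t * h n - d * h (n - 1).

Let d0 : d != 0. Proof. exact: lt0r_neq0 (lt_trans ltr01 d1). Qed.

Lemma homrec_eq0 h a : homrec h -> h a = 0 -> h (a + 1) = 0 -> forall n, h n = 0.
Proof.
move=> hh ha ha1.
have up (k : nat) : h (a + k%:Z) = 0 /\ h (a + k%:Z + 1) = 0.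
  elim: k => [|k [IH1 IH2]]; first by rewrite addr0.
  have -> : a + k.+1%:Z = a + k%:Z + 1 by lia.
  split=> //; rewrite hh IH2 (_ : _ + 1 - 1 = a + k%:Z); last lia.
  by rewrite IH1 !mulr0 subr0.
have down (k : nat) : h (a - k%:Z) = 0 /\ h (a - k%:Z + 1) = 0.
  elim: k => [|k [IH1 IH2]]; first by rewrite subr0.
  have := hh (a - k%:Z); rewrite IH1 IH2 mulr0 sub0r => /esym/eqP.
  rewrite oppr_eq0 mulf_eq0 (negPf d0) /= => /eqP e.
  have -> : a - k.+1%:Z = a - k%:Z - 1 by lia.
  by rewrite subrK e.
move=> n; case: (lerP a n) => an.
  have := (up `|n - a|%N).1; congr (h _ = _); lia.
have := (down `|a - n|%N).1; congr (h _ = _); lia.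
Qed.

Lemma affrec_sub x y : affrec x -> affrec y -> homrec (fun n => x n - y n).
Proof. by move=> hx hy n; rewrite hx hy; ring. Qed.

Lemma affrec_mix x y s : affrec x -> affrec y ->
  affrec (fun n => (1 - s) * x n + s * y n).
Proof. by move=> hx hy n; rewrite hx hy; ring. Qed.

Lemma affrec_shift x k : affrec x -> affrec (fun n => x (n + k)).
Proof. by move=> hx n /=; rewrite (addrAC n 1) hx (addrAC n k). Qed.

Lemma homrec_shift h k : homrec h -> homrec (fun n => h (n + k)).
Proof. by move=> hx n /=; rewrite (addrAC n 1) hx (addrAC n k). Qed.

Lemma affrec_inj x y a : affrec x -> affrec y -> x a = y a ->
  x (a + 1) = y (a + 1) -> x =1 y.
Proof.
move=> hx hy xa xa1 n; apply/subr0_eq.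
by apply: (homrec_eq0 _ a (affrec_sub _ _ hx hy)); [rewrite xa subrr|rewrite xa1 subrr].
Qed.

(* The abscissa of the fixed point of [fR]. *)
Definition fixabs : R := (1 - t + d)^-1.

Let fixden : 0 < 1 - t + d.
Proof.
have e : 0 <= (1 - t / 2) ^+ 2 by exact: sqr_ge0.
have E : (1 - t / 2) ^+ 2 = 1 - t + t ^+ 2 / 4 by field.
move: td; lra.
Qed.

Lemma fixabs_gt0 : 0 < fixabs.
Proof. by rewrite invr_gt0. Qed.

Lemma affrec_fix : affrec (fun=> fixabs).
Proof. by move=> n; rewrite /fixabs; field; rewrite gt_eqF. Qed.

(* Positive definite as [t ^+ 2 < 4 * d]. *)
Definition energy h n := h (n + 1) ^+ 2 - t * h n * h (n + 1) + d * h n ^+ 2.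

Lemma energyS h n : homrec h -> energy h (n + 1) = d * energy h n.
Proof. by move=> hh; rewrite /energy (hh (n + 1)) addrK; ring. Qed.

Lemma energy_le0 h n : energy h n <= 0 -> h n = 0 /\ h (n + 1) = 0.
Proof.
rewrite /energy => e.
have e0 : (h (n + 1) - t / 2 * h n) ^+ 2 + (d - t ^+ 2 / 4) * h n ^+ 2 <= 0.
  by apply: le_trans e; rewrite le_eqVlt; apply/orP; left; apply/eqP; field.
have h0 : h n = 0.
  apply/eqP; rewrite -sqrf_eq0 eq_le sqr_ge0 andbT.
  rewrite -(pmulr_rle0 _ (_ : 0 < d - t ^+ 2 / 4)) ?subr_gt0 //.
  by apply: le_trans e0; rewrite lerDr sqr_ge0.
split=> //; apply/eqP; rewrite -sqrf_eq0 eq_le sqr_ge0 andbT.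
by move: e0; rewrite h0 mulr0 subr0 expr0n /= mulr0 addr0.
Qed.

(** Over one period the energy of the deviation from the fixed point is unchanged, yet multiplied by
    [d ^+ k > 1]; hence it is zero. *)
Lemma affrec_periodic x a (k : nat) : affrec x -> (0 < k)%N ->
  x (a + k%:Z) = x a -> x (a + k%:Z + 1) = x (a + 1) -> x a = fixabs.
Proof.
move=> hx k0 e0 e1.
pose h n := x n - fixabs.
have hh : homrec h := affrec_sub _ _ hx affrec_fix.
have E (j : nat) : energy h (a + j%:Z) = d ^+ j * energy h a.
  elim: j => [|j IH]; first by rewrite addr0 mul1r.
  by rewrite (_ : _ + _ = a + j%:Z + 1) ?energyS ?IH ?exprS ?mulrA //; lia.
have := E k; rewrite {1}/energy /h e0 e1 -/(energy h a) => Ek.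
have dk : 1 < d ^+ k by rewrite exprn_egt1 // -lt0n.
have [h0 _] : h a = 0 /\ h (a + 1) = 0 by apply: energy_le0; nra.
exact/subr0_eq.
Qed.

(** The Casoratian, or discrete Wronskian. *)
Definition wronsk h1 h2 n := h1 n * h2 (n + 1) - h1 (n + 1) * h2 n.

Lemma wronskS h1 h2 n : homrec h1 -> homrec h2 ->
  wronsk h1 h2 (n + 1) = d * wronsk h1 h2 n.
Proof.
by move=> hh1 hh2; rewrite /wronsk (hh1 (n + 1)) (hh2 (n + 1)) addrK; ring.
Qed.

Lemma wronskD h1 h2 n (k : nat) : homrec h1 -> homrec h2 ->
  wronsk h1 h2 (n + k%:Z) = d ^+ k * wronsk h1 h2 n.
Proof.
move=> hh1 hh2; elim: k => [|k IH]; first by rewrite addr0 mul1r.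
rewrite (_ : _ + _ = n + k%:Z + 1); last lia.
by rewrite wronskS // IH exprS mulrA.
Qed.

(* [orbit P n] is the abscissa of [fR^n P]; the ordinate is [- d] times the
   abscissa one step earlier, whence [seqpt] below. *)
Definition orbit (P : R * R) n : R :=
  match n with
  | Posz k => (iter k (fR t d) P).1
  | Negz k => (iter k.+1 (fRinv t d) P).1
  end.

Lemma orbitN P (k : nat) : orbit P (- k%:Z) = (iter k (fRinv t d) P).1.
Proof. by case: k => [|k] //; rewrite -NegzE. Qed.

Lemma affrec_orbit P : affrec (orbit P).
Proof.
case=> [[|n]|n].
- by rewrite add0r sub0r -(NegzE 0) /=; field.
- rewrite (_ : _ + 1 = Posz n.+2); last lia.
  rewrite (_ : _ - 1 = Posz n); last lia.
  by rewrite /=; ring.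
- case: n => [|n].
    rewrite (_ : Negz 0 + 1 = 0) // (_ : Negz 0 - 1 = Negz 1) // /=.
    by rewrite /fRinv /=; field.
  rewrite (_ : _ + 1 = Negz n); last lia.
  rewrite (_ : _ - 1 = Negz n.+2); last lia.
  by rewrite [orbit P (Negz n)]/= [orbit P _]/= [orbit P (Negz _)]/= /fRinv /=;
    field.
Qed.

Lemma orbit0 P : orbit P 0 = P.1. Proof. by []. Qed.

Lemma orbitN1 P : orbit P (- 1) = - P.2 / d. Proof. by []. Qed.

Definition seqpt x : R * R := (x 0, - d * x (- 1)).

Lemma orbit_seqpt x : affrec x -> orbit (seqpt x) =1 x.
Proof.
move=> hx; apply: (@affrec_inj _ _ (- 1)) => //; first exact: affrec_orbit.
by rewrite orbitN1 /=; field.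
Qed.

Lemma seqpt_orbit P : seqpt (orbit P) = P.
Proof. by case: P => u v; rewrite /seqpt orbit0 orbitN1 /=; congr pair; field. Qed.

(** Turns each sign condition on [orbit P n] into an affine inequality in [P] with explicit
    coefficients. *)
Lemma orbit_affine P n : orbit P n =
  (orbit (1, 0) n - orbit (0, 0) n) * P.1 +
  (orbit (0, 1) n - orbit (0, 0) n) * P.2 + orbit (0, 0) n.
Proof.
move: n; apply: (@affrec_inj _ _ (- 1)).
- exact: affrec_orbit.
- by move=> n; rewrite !(affrec_orbit _ n); ring.
- by rewrite !orbitN1 /=; field.
- by rewrite addNr !orbit0 /=; ring.
Qed.

(* The orbit of [(s, 0)], shifted by one: the point preceding [(s, 0)] has
   abscissa 0 and becomes the term of index 0. *)
Definition axis s n := orbit (s, 0) (n - 1).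

Lemma affrec_axis s : affrec (axis s).
Proof. exact: (affrec_shift _ (- 1) (affrec_orbit _)). Qed.

Lemma axis0 s : axis s 0 = 0.
Proof. by rewrite /axis sub0r orbitN1 oppr0 mul0r. Qed.

Lemma axis1 s : axis s 1 = s.
Proof. by []. Qed.

Lemma axisE x : affrec x -> x 0 = 0 -> x =1 axis (x 1).
Proof.
move=> hx x0; apply: (@affrec_inj _ _ 0) => //; first exact: affrec_axis.
by rewrite x0 axis0.
Qed.

(** The homogeneous solution equal to 0 and 1 at the indices 0 and 1; it is also the rate of change
    of [axis s n] in [s]. *)
Definition fund n := axis 1 n - axis 0 n.

Lemma homrec_fund : homrec fund.
Proof. exact: affrec_sub (affrec_axis _) (affrec_axis _). Qed.

Lemma fund0 : fund 0 = 0. Proof. by rewrite /fund !axis0 subrr. Qed.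
Lemma fund1 : fund 1 = 1. Proof. by rewrite /fund !axis1 subr0. Qed.

Lemma fundN1 : d * fund (- 1) = - 1.
Proof. by have := homrec_fund 0; rewrite add0r fund1 fund0 sub0r; lra. Qed.

(** The solutions [fund n] and [- d * fund (n - 1)] form the basis dual to the values at two
    consecutive indices. *)
Lemma homrecE h a n : homrec h ->
  h (a + n) = h (a + 1) * fund n - d * h a * fund (n - 1).
Proof.
move=> hh; apply/subr0_eq.
pose g n := h (n + a) - (h (a + 1) * fund n - d * h a * fund (n - 1)).
have gh : homrec g.
  move=> m; rewrite /g (addrAC m 1) (hh (m + a)) (addrAC m a) (homrec_fund m) addrK.
  by have := homrec_fund (m - 1); rewrite subrK => ->; ring.
rewrite (addrC a n) -/(g n); apply: (@homrec_eq0 _ 0 gh); rewrite /g.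
  rewrite !add0r fund0 mulr0 sub0r opprK -mulrA mulrCA fundN1; ring.
by rewrite !add0r (addrC 1) subrr fund0 fund1; ring.
Qed.

(** Compare the Casoratian of [fund] and its translate by [n] at the indices [- n] and 0. *)
Lemma fundN (n : nat) : d ^+ n * fund (- n%:Z) = - fund n%:Z.
Proof.
have h1 := homrec_fund; have h2 := homrec_shift _ n%:Z h1.
have := wronskD _ _ (- n%:Z) n h1 h2; rewrite addNr /wronsk; cbv beta.
rewrite (_ : - n%:Z + 1 + n%:Z = 1); last lia.
by rewrite addNr !add0r fund0 fund1 mul0r mulr0 mulr1 mul1r sub0r subr0 => ->.
Qed.

Lemma affrec_fund x y a n : affrec x -> affrec y -> x a = y a ->
  y (a + n) - x (a + n) = (y (a + 1) - x (a + 1)) * fund n.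
Proof.
move=> hx hy e; rewrite (homrecE _ a n (affrec_sub _ _ hy hx)) /= e subrr.
by rewrite mulr0 mul0r subr0.
Qed.

Lemma axis_fund s s' n : axis s' n - axis s n = (s' - s) * fund n.
Proof.
have := affrec_fund _ _ 0 n (affrec_axis s) (affrec_axis s').
by rewrite !axis0 !add0r !axis1; apply.
Qed.

(* The sequence [axis 1] vanishes at both 0 and -1. *)
Lemma axis1_fund n : axis 1 n - axis 1 (n - 1) = fund n.
Proof.
have := homrecE _ 0 n
  (affrec_sub _ _ (affrec_axis 1) (affrec_shift _ (- 1) (affrec_axis 1))).
rewrite /= !add0r axis1 subrr axis0 => ->.
have := affrec_axis 1 0; rewrite add0r sub0r axis0 axis1 mulr0 => e.
suff -> : axis 1 (- 1) = 0 by rewrite subr0; ring.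
by apply: (mulfI d0); rewrite mulr0; move: e; lra.
Qed.

Lemma axis1N1 : axis 1 (- 1) = 0.
Proof. by have := axis1_fund 0; rewrite sub0r axis0 fund0; lra. Qed.

(** Homogeneous solutions form a plane, so any three are linearly dependent. *)
Lemma homrec_det h1 h2 h3 i j k : homrec h1 -> homrec h2 -> homrec h3 ->
  h1 i * (h2 j * h3 k - h2 k * h3 j) - h1 j * (h2 i * h3 k - h2 k * h3 i)
  + h1 k * (h2 i * h3 j - h2 j * h3 i) = 0.
Proof.
move=> hh1 hh2 hh3.
have E h n : homrec h -> h n = h 1 * fund n - d * h 0 * fund (n - 1).
  by move=> hh; have := homrecE h 0 n hh; rewrite !add0r.
by rewrite (E h1 i) ?(E h1 j) ?(E h1 k) ?(E h2 i) ?(E h2 j) ?(E h2 k)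
  ?(E h3 i) ?(E h3 j) ?(E h3 k) //; ring.
Qed.

(** * Bounds and positivity along backward orbits *)

Lemma affrec_bound a (M : R) (i : nat) : 0 <= M ->
  exists M', forall x, affrec x -> `|x a| <= M -> `|x (a + 1)| <= M ->
    `|x (a + i%:Z)| <= M' /\ `|x (a + i%:Z + 1)| <= M'.
Proof.
move=> M0; elim: i => [|i [M' IH]].
  by exists M => x hx; rewrite addr0.
exists ((1 + `|t| + d) * `|M'| + 1) => x hx xa xa1.
have [x0 x1] := IH x hx xa xa1.
have d_gt0 : 0 < d := lt_trans ltr01 d1.
have M'0 : 0 <= M' := le_trans (normr_ge0 _) x0.
rewrite (_ : a + i.+1%:Z = a + i%:Z + 1); last by rewrite -addrA -PoszD addn1.
rewrite (ger0_norm M'0); have t0 := normr_ge0 t.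
split; first by nra.
rewrite hx addrK.
have : `|t * x (a + i%:Z + 1) - d * x (a + i%:Z) + 1| <=
    `|t| * `|x (a + i%:Z + 1)| + d * `|x (a + i%:Z)| + 1.
  rewrite (le_trans (ler_normD _ _)) // normr1 lerD2r.
  by rewrite (le_trans (ler_normB _ _)) // !normrM (gtr0_norm d_gt0).
by nra.
Qed.

(** Let [k] be the first positive index where [fund] is nonpositive. As [x (a + 1)] and [x (a + k)]
    are nonnegative, [homrecE] bounds [x a] from above. Applied at [- k - 1] and [- k], this bound
    is carried by [k] forward steps to the indices -1 and 0, which determine the point. *)
Lemma bounded_backward_ge0 (q : nat) : (0 < q)%N -> fund q%:Z <= 0 ->
  bounded_set [set P | forall n, n <= 0 -> 0 <= orbit P n].
Proof.
move=> q0 fq.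
have ex : exists k : nat, (0 < k)%N && (fund k%:Z <= 0) by exists q; rewrite q0.
case: (ex_minnP ex) => k /andP[k0 fk] kmin {ex q q0 fq}.
have k1 : (1 < k)%N.
  by rewrite ltn_neqAle k0 andbT; apply/eqP => k1; move: fk; rewrite -k1 fund1; lra.
have fk1 : 0 < fund (k%:Z - 1).
  rewrite (_ : k%:Z - 1 = k.-1%:Z); last lia.
  by rewrite ltNge; apply/negP => h; have := kmin k.-1; rewrite h; lia.
have d_gt0 : 0 < d := lt_trans ltr01 d1.
have f0 := fixabs_gt0.
pose c := d * fund (k%:Z - 1).
have c0 : 0 < c by rewrite mulr_gt0.
pose M := fixabs * (1 - fund k%:Z + c) / c.
have M0 : 0 <= M by rewrite divr_ge0 ?mulr_ge0 //; lra.
have bnd x a : affrec x -> (forall n, n <= 0 -> 0 <= x n) ->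
    a + k%:Z <= 0 -> `|x a| <= M.
  move=> hx xge ak; rewrite ger0_norm; last by apply: xge; lia.
  rewrite ler_pdivlMr //.
  have := homrecE _ a k%:Z (affrec_sub _ _ hx affrec_fix).
  have := xge _ ak; have : 0 <= x (a + 1) by apply: xge; lia.
  by rewrite /= mulrAC -/c; nra.
have [M' hM'] := affrec_bound (- k%:Z - 1) M k M0.
exists (Num.max M' (d * M')); split; first exact: num_real.
move=> M2 hM2 P /= hP.
have hx := affrec_orbit P.
have e : - k%:Z - 1 + k%:Z = - 1 by rewrite addrAC addNr sub0r.
have [||] := hM' (orbit P) hx.
- by apply: bnd => //; rewrite e.
- by apply: bnd => //; rewrite subrK addNr.
rewrite e addNr => P2 P1.
rewrite -(seqpt_orbit P) prod_normE /= ge_max normrM normrN (gtr0_norm d_gt0).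
move: hM2; rewrite gt_max => /andP[hM1 hM2'].
rewrite (le_trans P1 (ltW hM1)) (le_trans _ (ltW hM2')) //.
by rewrite ler_pM2l.
Qed.

Section NoLongRun.
Context (p : nat).
Context (norun0 : forall s, ~ forall n : int, 0 < n <= p%:Z -> 0 < axis s n).
Implicit Types (z w : int -> R) (i j : int).

(* Moving towards the fixed point turns a nonpositive term into a zero while
   keeping the positive terms positive. *)
Lemma no_long_run y a : affrec y -> y a <= 0 ->
  (forall n, a < n <= a + p%:Z -> 0 <= y n /\ (y a < 0 \/ 0 < y n)) -> False.
Proof.
move=> hy ya ypos.
have f0 := fixabs_gt0.
have fy : 0 < fixabs - y a by rewrite subr_gt0 (le_lt_trans ya).
(* The weight that makes the mixture below vanish at [a]. *)
pose s := fixabs / (fixabs - y a).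
have s0 : 0 < s by rewrite divr_gt0.
have s1 : s <= 1 by rewrite ler_pdivrMr // mul1r; lra.
pose g n := (1 - s) * fixabs + s * y n.
have hg : affrec g by apply: affrec_mix => //; exact: affrec_fix.
have ga : g (0 + a) = 0 by rewrite add0r /g /s; field; rewrite gt_eqF.
have hga := affrec_shift _ a hg.
apply: (norun0 (g (1 + a))) => n nb.
rewrite -(axisE _ hga ga) /g.
have [|yn [ya0|yn0]] := ypos (n + a); first lia.
(* Here the fixed point has positive weight, so nonnegative terms of [y] become positive. *)
- have : s < 1 by rewrite ltr_pdivrMr // mul1r; lra.
  move=> s1'; apply: ltr_pwDl; first by apply: mulr_gt0; rewrite ?subr_gt0.
  by apply: mulr_ge0 => //; exact: ltW.
- apply: ltr_wpDl; last exact: mulr_gt0.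
  by apply: mulr_ge0; [rewrite subr_ge0|exact: ltW].
Qed.

(** Otherwise the nonpositive term closest to the window would be followed by [p] positive ones. *)
Lemma backward_gt0 x b : affrec x ->
  (forall n, b - p%:Z < n <= b -> 0 < x n) -> forall n, n <= b -> 0 < x n.
Proof.
move=> hx xpos n nb; rewrite (_ : n = b - `|b - n|%N%:Z); last lia.
elim/ltn_ind: {n nb}(`|b - n|%N) => k IH.
have [kp|pk] := ltnP k p; first by apply: xpos; lia.
rewrite ltNge; apply/negP => xk; apply: (no_long_run x (b - k%:Z)) => // n nb.
have xn : 0 < x n.
  by have := IH `|b - n|%N; rewrite (_ : b - `|b - n|%N%:Z = n); [apply|]; lia.
by split; [exact: ltW|right].
Qed.

Lemma backward_ge0 x b : affrec x ->
  (forall n, b - p%:Z < n <= b -> 0 <= x n) -> forall n, n <= b -> 0 <= x n.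
Proof.
move=> hx xpos n nb; rewrite (_ : n = b - `|b - n|%N%:Z); last lia.
elim/ltn_ind: {n nb}(`|b - n|%N) => k IH.
have [kp|pk] := ltnP k p; first by apply: xpos; lia.
rewrite leNgt; apply/negP => xk.
apply: (no_long_run x (b - k%:Z)) => //; first exact: ltW.
move=> n nb; split; last by left.
by have := IH `|b - n|%N; rewrite (_ : b - `|b - n|%N%:Z = n); [apply|]; lia.
Qed.

Lemma backward_axis_ge0 y : affrec y -> y 0 = 0 ->
  (forall n, 0 < n < p%:Z -> 0 <= y n) -> forall n, n < p%:Z -> 0 <= y n.
Proof.
move=> hy y0 ypos n np; apply: (backward_ge0 _ (p%:Z - 1)) => //; last lia.
move=> k kb.
by have [->|k0] := eqVneq k 0; [rewrite y0|apply: ypos; lia].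
Qed.

(** The midpoint of [x] and [w] works. A zero at [n < 0] would be common to [x] and [w], which
    differ at [q], so [fund n = 0]. Then [axis 1] vanishes at [n - 1] and [n] as it does at -1 and
    0, and is periodic, contradicting [affrec_periodic]. *)
Lemma pinned_seq x w (q : nat) : affrec x -> affrec w ->
  x 0 = 0 -> w 0 = 0 -> w q%:Z = 0 -> (0 < q < p)%N ->
  (forall n, 0 < n < p%:Z -> 0 < x n) -> (forall n, 0 < n < p%:Z -> 0 <= w n) ->
  exists z, [/\ affrec z, z 0 = 0 & forall n, n != 0 -> n < p%:Z -> 0 < z n].
Proof.
move=> hx hw x0 w0 wq qp xpos wpos.
have xge := backward_axis_ge0 x hx x0 (fun n nb => ltW (xpos n nb)).
have wge := backward_axis_ge0 w hw w0 wpos.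
exists (fun n => (1 - 2^-1) * x n + 2^-1 * w n); split.
- exact: affrec_mix.
- by rewrite x0 w0 !mulr0 addr0.
move=> n n0 np; have wn := wge n np; have xn := xge n np.
have [n_gt0|n_le0] := ltrP 0 n.
  have xn' : 0 < x n by apply: xpos; rewrite n_gt0.
  by lra.
rewrite ltNge; apply/negP => zn.
have [xn0 wn0] : x n = 0 /\ w n = 0 by split; lra.
have fn0 : fund n = 0.
  have := affrec_fund w x 0 n hw hx; rewrite w0 x0 add0r xn0 wn0 subrr.
  move=> /(_ erefl) /esym/eqP; rewrite mulf_eq0 => /orP[|/eqP//].
  rewrite add0r subr_eq0 => /eqP e.
  have := affrec_inj x w 0 hx hw; rewrite x0 w0 add0r => /(_ erefl e q%:Z).
  rewrite wq => xq; have : 0 < x q%:Z by apply: xpos; lia.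
  by rewrite xq ltxx.
have cn : axis 1 n = 0.
  by have := axis_fund (x 1) 1 n; rewrite -(axisE _ hx x0) xn0 fn0; lra.
have cn1 : axis 1 (n - 1) = 0 by have := axis1_fund n; rewrite cn fn0; lra.
have := affrec_periodic (axis 1) (n - 1) `|n| (affrec_axis 1).
have -> : n - 1 + `|n|%N%:Z = - 1 by lia.
have -> : - 1 + 1 = 0 :> int by [].
rewrite subrK axis1N1 axis0 cn cn1 absz_gt0 => /(_ n0 erefl erefl) e.
by have := fixabs_gt0; rewrite -e ltxx.
Qed.

(** * The vertices of [G] and their cyclic order *)

Section Vertices.
Context (z : int -> R) (hz : affrec z) (z0 : z 0 = 0).
Context (zpos : forall n, n != 0 -> n < p%:Z -> 0 < z n).

(* With [i < j < k] zeros of [x] and [A], [B], [C] the differences with [x] of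
   the translates of [z] vanishing at [i], [j], [k], the determinant of
   [(A, B, C)] at [(i, j, k)] has zero diagonal and positive other entries, so
   it is positive; but [A], [B], [C] lie in a plane. *)
Lemma no_three_zeros x i j k : affrec x -> i < j -> j < k -> k - i < p%:Z ->
  x i = 0 -> x j = 0 -> x k = 0 -> False.
Proof.
move=> hx ij jk kip xi xj xk.
have hh l : homrec (fun n => z (n - l) - x n).
  exact: affrec_sub (affrec_shift _ (- l) hz) hx.
have := homrec_det _ _ _ i j k (hh i) (hh j) (hh k).
rewrite /= xi xj xk !subrr z0 !subr0.
have zji : 0 < z (j - i) by apply: zpos; lia.
have zij : 0 < z (i - j) by apply: zpos; lia.
have zki : 0 < z (k - i) by apply: zpos; lia.
have zik : 0 < z (i - k) by apply: zpos; lia.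
have zkj : 0 < z (k - j) by apply: zpos; lia.
have zjk : 0 < z (j - k) by apply: zpos; lia.
have := mulr_gt0 (mulr_gt0 zji zkj) zik.
have := mulr_gt0 (mulr_gt0 zki zij) zjk.
by lra.
Qed.

(** In this range a zero at [n], together with those at 0 and [q], would give three zeros spanning
    less than [p]. *)
Lemma two_zeros w (q : nat) n : affrec w -> w 0 = 0 -> w q%:Z = 0 ->
  (0 < q < p)%N -> (forall n, 0 < n < p%:Z -> 0 <= w n) ->
  q%:Z - p%:Z < n < p%:Z -> n != 0 -> n != q%:Z -> 0 < w n.
Proof.
move=> hw w0 wq qp wpos nb n0 nq.
have wge := backward_axis_ge0 w hw w0 wpos.
rewrite lt_neqAle wge ?andbT; last lia.
apply/eqP => /esym wn.
have [nlt|nge] := ltrP n 0.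
  by apply: (no_three_zeros w n 0 q%:Z) => //; lia.
have [nlq|ngq] := ltrP n q%:Z.
  by apply: (no_three_zeros w 0 n q%:Z) => //; lia.
by apply: (no_three_zeros w 0 q%:Z n) => //; lia.
Qed.

Context (q1 q2 : nat) (q1_gt0 : (0 < q1)%N) (q2_gt0 : (0 < q2)%N).
Context (q12 : (q1 + q2 = p)%N).
Context (w1 : int -> R) (hw1 : affrec w1) (w10 : w1 0 = 0) (w1q : w1 q1%:Z = 0).
Context (w1pos : forall n, 0 < n < p%:Z -> 0 <= w1 n).
Context (w2 : int -> R) (hw2 : affrec w2) (w20 : w2 0 = 0) (w2q : w2 q2%:Z = 0).
Context (w2pos : forall n, 0 < n < p%:Z -> 0 <= w2 n).
Context (fq1 : 0 < fund q1%:Z) (fq2 : fund q2%:Z < 0).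

(* The vertex shared by the edges on [Sigma_j] and on its predecessor, that is
   [Sigma_(j - q1)] or [Sigma_(j + q2)]. *)
Definition vseq (j : nat) n :=
  if (q1 <= j)%N then w1 (n + j%:Z) else w2 (n + j%:Z + q2%:Z).

Lemma affrec_vseq (j : nat) : affrec (vseq j).
Proof.
rewrite /vseq; case: (q1 <= j)%N; first exact: (affrec_shift w1 j%:Z hw1).
exact: (affrec_shift (fun n => w2 (n + q2%:Z)) j%:Z (affrec_shift w2 q2%:Z hw2)).
Qed.

Lemma vseq0 (j : nat) : vseq j (- j%:Z) = 0.
Proof.
by rewrite /vseq; case: ifP => _; rewrite addNr // add0r.
Qed.

Lemma vseq_succ0 (j : nat) : (j < p)%N -> vseq (next_edge q1 q2 j) (- j%:Z) = 0.
Proof.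
rewrite /vseq /next_edge => jp; case: ltnP => jq.
  by rewrite leq_addl (_ : _ + _ = q1%:Z) //; lia.
case: ifP => qj; first lia.
by rewrite (_ : _ + _ = 0) //; lia.
Qed.

Lemma vseq_gt0 (i j : nat) : (i < p)%N -> (j < p)%N -> i != j ->
  next_edge q1 q2 i != j -> 0 < vseq j (- i%:Z).
Proof.
rewrite /vseq /next_edge => ip jp ij.
case: (leqP q1 j) => jq nij.
  by apply: (two_zeros w1 q1) => //; move: nij; case: ltnP; lia.
by apply: (two_zeros w2 q2) => //; move: nij; case: ltnP; lia.
Qed.

(** The predecessor is [j - q1] or [j + q2], so the value of [fund] is at [q1] or [- q2]; [fundN]
    gives the sign of the latter. The opposite signs at [q1] and [q2] force [q1 <> q2], which
    separates predecessor from successor. *)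
Lemma prev_edge (j : nat) : (j < p)%N ->
  exists i : nat,
    [/\ (i < p)%N, next_edge q1 q2 i = j, i != next_edge q1 q2 j
      & 0 < fund (j%:Z - i%:Z)].
Proof.
have q12_neq : q1 <> q2 by move=> e; move: fq1 fq2; rewrite e; lra.
move=> jp; rewrite /next_edge; case: (leqP q1 j) => jq.
  exists (j - q1)%N; split.
  - lia.
  - by case: ifP; lia.
  - by case: ifP; lia.
  - by rewrite (_ : _ - _ = q1%:Z) //; lia.
exists (j + q2)%N; split.
- lia.
- by case: ifP; lia.
- by case: ifP; lia.
- rewrite (_ : _ - _ = - q2%:Z); last lia.
  rewrite -(pmulr_rgt0 _ (_ : 0 < d ^+ q2)) ?fundN ?oppr_gt0 //.
  by rewrite exprn_gt0 // (lt_trans ltr01).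
Qed.

(** Both sequences vanish at [- j], so they differ by a multiple of a translate of [fund]. Its sign
    is read off at [- i], with [i] the predecessor of [j]: there the first vanishes and the second
    is positive. *)
Lemma vseq_slope (j : nat) : (j < p)%N ->
  vseq j (- j%:Z + 1) < vseq (next_edge q1 q2 j) (- j%:Z + 1).
Proof.
move=> jp; have [i [ip nij inj fji]] := prev_edge j jp.
have := affrec_fund (vseq j) (vseq (next_edge q1 q2 j)) (- j%:Z) (j%:Z - i%:Z)
  (affrec_vseq _) (affrec_vseq _).
rewrite vseq0 vseq_succ0 // => /(_ erefl).
rewrite addrA addNr sub0r -{2}nij vseq_succ0 // subr0 => e.
rewrite -subr_gt0 -(pmulr_lgt0 _ fji) -e vseq_gt0 //.
- by rewrite /next_edge; case: ifP; lia.
- by rewrite nij; rewrite /next_edge; case: ifP; lia.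
Qed.

(** The cross product is a Casoratian at 0, whose sign can be computed at [- j], where both
    deviations equal [- fixabs]. *)
Lemma cross_vseq (j : nat) : (j < p)%N ->
  cross (seqpt (vseq j) - seqpt (fun=> fixabs))
        (seqpt (vseq (next_edge q1 q2 j)) - seqpt (fun=> fixabs)) < 0.
Proof.
move=> jp.
pose g (k : nat) n := vseq k n - fixabs.
have hg (k : nat) : homrec (g k) := affrec_sub _ _ (affrec_vseq k) affrec_fix.
have d_gt0 : 0 < d := lt_trans ltr01 d1.
have -> : cross (seqpt (vseq j) - seqpt (fun=> fixabs))
    (seqpt (vseq (next_edge q1 q2 j)) - seqpt (fun=> fixabs)) =
    wronsk (g j) (g (next_edge q1 q2 j)) 0.
  rewrite -(addNr 1) wronskS // /wronsk /cross /seqpt /g /= addNr; ring.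
rewrite -(addNr j%:Z) wronskD // pmulr_rlt0 ?exprn_gt0 //.
rewrite /wronsk /g vseq0 vseq_succ0 //.
by have := vseq_slope j jp; have := fixabs_gt0; nra.
Qed.

Lemma backward_window P : (forall i : nat, (i < p)%N -> 0 < orbit P (- i%:Z)) ->
  forall n, n <= 0 -> 0 < orbit P n.
Proof.
move=> h; apply: backward_gt0; first exact: affrec_orbit.
move=> n nb; rewrite (_ : n = - `|n|%N%:Z); last lia.
by apply: h; lia.
Qed.

Lemma backward_polygon (m : nat) : coprime m p ->
  (exists k : nat, (m * q1 = k * p + 1)%N) ->
  (exists (v : 'I_p -> R * R) (T : 'I_p -> set (R * R)),
     [/\ open_polygon v (G t d), clockwise v,
         forall j : 'I_p, T j `<=` Sigma t d j
       & forall i : 'I_p, edge v i = T (rotation_perm m i)])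
  /\ G t d = iter p.-1 (fR t d) @` F t d p.
Proof.
move=> cop [k mq1].
have p_gt0 : (0 < p)%N by lia.
have p3 : (3 <= p)%N.
  suff : q1 <> q2 by lia.
  by move=> e; move: fq1 fq2; rewrite e; lra.
have GE : G t d = [set P | forall i : nat, (i < p)%N -> 0 < orbit P (- i%:Z)].
  apply/seteqP; split=> [P PG i _|P /backward_window h j].
    by rewrite orbitN; exact: PG.
  by rewrite /OmegaR /= -orbitN; apply: h; lia.
(* Forward iterates of the preimage [p - 1] steps back are the backward iterates of the point, in
   reverse order. *)
split; last first.
  have fRK' := fRK t d0; have fRinvK' := fRinvK t d0.
  apply/seteqP; split=> [P PG|_ [Q QF <-]].
    exists (iter p.-1 (fRinv t d) P); last first.
      by rewrite (iterK_sub _ _ _ _ _ _ fRinvK') // subnn.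
    move=> j jp; rewrite (iterK_sub _ _ _ _ _ _ fRinvK'); last lia.
    exact: PG.
  rewrite GE => i ip; rewrite orbitN (iterK_sub _ _ _ _ _ _ fRK'); last lia.
  by apply: QF; lia.
pose r (i : 'I_p) : 'I_p := rotation_perm m i.
have r_inj : injective r := bij_inj (rotation_perm_bij cop).
have rS (i : 'I_p) : r (ordS i) = next_edge q1 q2 (r i) :> nat.
  exact: rotation_perm_ordS cop q12 mq1.
pose g (j : 'I_p) := Ordinal (ltn_pmod (j * m) p_gt0).
have gr (i : 'I_p) : g (r i) = i.
  by apply: val_inj; exact: rotation_perm_mod.
have rg (i : 'I_p) : r (g i) = i by apply: rotation_permE.
pose v (i : 'I_p) := seqpt (vseq (r i)).
pose a (i : 'I_p) := orbit (1, 0) (- (r i)%:Z) - orbit (0, 0) (- (r i)%:Z).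
pose b (i : 'I_p) := orbit (0, 1) (- (r i)%:Z) - orbit (0, 0) (- (r i)%:Z).
pose c (i : 'I_p) := orbit (0, 0) (- (r i)%:Z).
pose center := seqpt (fun=> fixabs).
have sideE (i : 'I_p) P : side a b c i P = orbit P (- (r i)%:Z) by rewrite orbit_affine.
have sv (i j : 'I_p) : side a b c i (v j) = vseq (r j) (- (r i)%:Z).
  by rewrite sideE orbit_seqpt //; exact: affrec_vseq.
have GU : G t d = [set P | forall i : 'I_p, 0 < side a b c i P].
  rewrite GE; apply/seteqP; split=> P /= h; [move=> i|move=> i ip].
    by rewrite sideE; apply: h.
  by have := h (g (Ordinal ip)); rewrite sideE rg.
have s0 (i : 'I_p) : side a b c i (v i) = 0 by rewrite sv vseq0.
have sS (i : 'I_p) : side a b c i (v (ordS i)) = 0 by rewrite sv rS vseq_succ0.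
have s_gt0 (i j : 'I_p) : j != i -> j != ordS i -> 0 < side a b c i (v j).
  move=> ji jS; rewrite sv vseq_gt0 //.
    by rewrite eq_sym (inj_eq val_inj) (inj_eq r_inj).
  by rewrite -rS eq_sym (inj_eq val_inj) (inj_eq r_inj).
have sc (i : 'I_p) : 0 < side a b c i center.
  by rewrite sideE orbit_seqpt ?fixabs_gt0 //; exact: affrec_fix.
have bounded : bounded_set [set P | forall i : 'I_p, 0 < side a b c i P].
  have [M [Mreal hM]] := bounded_backward_ge0 q2 q2_gt0 (ltW fq2).
  exists M; split=> // M' MM' P; rewrite -GU GE => /backward_window h.
  by apply: (hM M' MM') => n n0; apply/ltW/h.
(* The edge of rank [i] lies on [Sigma] of index [r i], and [g] inverts [r]. *)
exists v, (fun j : 'I_p => edge v (g j)); split.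
- rewrite GU; exact: (convex_open_polygon v a b c center p3 s0 sS s_gt0 sc bounded).
- apply: (clockwise_center v center p3) => i.
  by rewrite /v rS; apply: cross_vseq.
- move=> j P Pj; have := side_edge v a b c s0 sS _ _ Pj.
  rewrite sideE rg orbitN => P0; exists (iter j (fRinv t d) P) => //.
  by rewrite (iterK_sub _ _ _ _ _ _ (fRinvK t d0)) // subnn.
- by move=> i; rewrite gr.
Qed.

End Vertices.
End NoLongRun.

(** * First returns to the axis *)

Lemma iter_f tauL P (k : nat) :
  (forall j : nat, (j < k)%N -> 0 < (iter j (fR t d) P).1) ->
  iter k (f tauL t d) P = iter k (fR t d) P.
Proof.
elim: k => [//|k IH] h; rewrite !iterS IH => [|j jk]; last by apply: h; lia.
by rewrite /f leNgt h.
Qed.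

Lemma axisS s (k : nat) : axis s k.+1%:Z = (iter k (fR t d) (s, 0)).1.
Proof. by rewrite /axis (_ : k.+1%:Z - 1 = k) //; lia. Qed.

(** At a positive abscissa [f] is [fR] and the next ordinate is nonzero; at the first nonpositive
    one [fL] sends it to 0. Index [n] of [axis s] is the abscissa after [n - 1] steps. *)
Lemma is_N_axis tauL s (n : nat) : is_N tauL t d s n ->
  (forall l : int, 0 < l < n%:Z -> 0 < axis s l) /\ axis s n%:Z <= 0.
Proof.
case=> n0 Nn Nlt.
have pos (k : nat) : (k.+1 < n)%N -> 0 < (iter k (fR t d) (s, 0)).1.
  elim/ltn_ind: k => k IH kn; rewrite ltNge; apply/negP => le0.
  have := Nlt k.+1; rewrite kn => /(_ isT).
  rewrite iterS iter_f => [|j jk]; last by apply: IH => //; lia.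
  by rewrite /f le0 /= eqxx.
split=> [l ln|].
  have -> : l = (`|l|%N.-1).+1%:Z by lia.
  by rewrite axisS; apply: pos; lia.
case: n n0 Nn {Nlt} pos => // n _ + pos.
rewrite axisS iterS iter_f => [|j jn]; last exact: pos.
rewrite /f; case: ifP => // /negbT; rewrite -ltNge => gt0 /= /eqP.
by rewrite mulf_eq0 oppr_eq0 (negPf d0) (gt_eqF gt0).
Qed.

(** * Corner sequences from the ordering of the return-time intervals *)

Section Rotation.
Context (tauL : R) (p nstar : nat) (D : seq nat).
Context (hstar : is_N tauL t d 1 nstar).
Context (nonempty_mem :
  forall n : nat, (1 <= n)%N -> (I_ tauL t d n !=set0 <-> n \in D)).
Context (covered : forall s, s <= 1 -> exists n : nat, I_ tauL t d n s).
Context (ordered : forall i j : nat, (i < j < size D)%N -> forall s u,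
  I_ tauL t d (nth 0%N D i) s -> I_ tauL t d (nth 0%N D j) u -> s < u).
Context (D_le : forall q, q \in D -> (q <= p)%N).

Lemma I_mem (n : nat) s : I_ tauL t d n s -> n \in D.
Proof.
by move=> Is; apply/nonempty_mem; [case: Is => _ []|exists s].
Qed.

Lemma no_long_axis_run s : ~ forall n : int, 0 < n <= p%:Z -> 0 < axis s n.
Proof.
move=> spos; have [s1|s1] := leP s 1.
  have [n In] := covered s s1; have np := D_le n (I_mem _ _ In).
  have [_ Nn] := In; have [_ le0] := is_N_axis _ _ _ Nn.
  have : 0 < axis s n%:Z by apply: spos; case: Nn; lia.
  by rewrite ltNge le0.
have I1 : I_ tauL t d nstar 1 by split.
have np := D_le _ (I_mem _ _ I1).
have [pos le0] := is_N_axis _ _ _ hstar.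
have n0 : (0 < nstar)%N by case: hstar.
have n1 : (1 < nstar)%N.
  rewrite ltn_neqAle n0 andbT; apply/eqP => e.
  by move: le0; rewrite -e axis1; lra.
(* The sequence [axis 1] falls from a positive to a nonpositive value at [nstar]. Hence
   [axis s nstar] decreases in [s] and stays nonpositive for [s > 1]. *)
have fn : fund nstar%:Z < 0.
  have p1 : 0 < axis 1 (nstar%:Z - 1) by apply: pos; lia.
  by rewrite -axis1_fund; lra.
have : 0 < axis s nstar%:Z by apply: spos; lia.
by have := axis_fund 1 s nstar%:Z; nra.
Qed.

Lemma between (i : nat) s u r : (i.+1 < size D)%N ->
  I_ tauL t d (nth 0%N D i) s -> I_ tauL t d (nth 0%N D i.+1) u ->
  s <= r <= u ->
  I_ tauL t d (nth 0%N D i) r \/ I_ tauL t d (nth 0%N D i.+1) r.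
Proof.
move=> iD Is Iu /andP[sr ru].
have [n Ir] : exists n : nat, I_ tauL t d n r.
  by apply: covered; apply: le_trans ru _; case: Iu.
have nD := I_mem _ _ Ir; have kD := nD; rewrite -index_mem in kD.
rewrite -(nth_index 0%N nD) in Ir; move: kD Ir; set k := index n D => kD Ir.
have [ki|ik] := ltnP k i.
  by have := ordered k i; rewrite ki (ltnW iD) => /(_ isT _ _ Ir Is); lra.
have [ki|ik'] := ltnP i.+1 k.
  by have := ordered i.+1 k; rewrite ki kD => /(_ isT _ _ Iu Ir); lra.
have [e|ne] := eqVneq k i; first by left; rewrite -e.
by right; rewrite (_ : i.+1 = k) //; lia.
Qed.

(** The corner is the parameter between [s] and [u] at which term [q] reaches zero. A negative term
    before [p] would have vanished at a parameter closer to [s], where term [q] is still positive: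
    such a parameter belongs to neither interval. *)
Lemma corner_seq (q : nat) s u : (0 < q < p)%N ->
  I_ tauL t d p s -> I_ tauL t d q u ->
  (forall e, 0 <= e <= 1 -> I_ tauL t d p (s + e * (u - s)) \/
                            I_ tauL t d q (s + e * (u - s))) ->
  exists w, [/\ affrec w, w 0 = 0, w q%:Z = 0 &
    forall n : int, 0 < n < p%:Z -> 0 <= w n].
Proof.
move=> qp Is Iu seg.
have [spos _] := is_N_axis _ _ _ Is.2; have [_ uq] := is_N_axis _ _ _ Iu.2.
have sq : 0 < axis s q%:Z by apply: spos; lia.
have E e (n : int) : axis (s + e * (u - s)) n = axis s n + e * (axis u n - axis s n).
  have := axis_fund s (s + e * (u - s)) n; have -> := axis_fund s u n.
  have -> : s + e * (u - s) - s = e * (u - s) by ring.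
  by rewrite -mulrA; lra.
pose e0 := axis s q%:Z / (axis s q%:Z - axis u q%:Z).
have den : 0 < axis s q%:Z - axis u q%:Z by lra.
have e0q : e0 * (axis s q%:Z - axis u q%:Z) = axis s q%:Z by rewrite divfK // gt_eqF.
have e00 : 0 < e0 by rewrite divr_gt0.
have e01 : e0 <= 1 by rewrite ler_pdivrMr // mul1r; lra.
exists (axis (s + e0 * (u - s))); split.
- exact: affrec_axis.
- exact: axis0.
- by rewrite E; lra.
move=> n np; rewrite leNgt; apply/negP => wn.
have sn := spos n np.
(* Fraction of the way from [s] to the corner at which term [n] vanishes. *)
pose c := axis s n / (axis s n - axis (s + e0 * (u - s)) n).
have den' : 0 < axis s n - axis (s + e0 * (u - s)) n by lra.
have c0 : 0 < c by rewrite divr_gt0.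
have c1 : c < 1 by rewrite ltr_pdivrMr // mul1r; lra.
have cn : c * (axis s n - axis (s + e0 * (u - s)) n) = axis s n.
  by rewrite divfK // gt_eqF.
have ce : 0 <= c * e0 <= 1 by apply/andP; split; nra.
have zn : axis (s + c * e0 * (u - s)) n = 0.
  by move: cn; rewrite !E; lra.
case: (seg _ ce) => [[_ /is_N_axis[pos _]]|[_ /is_N_axis[_ le0]]].
  by have := pos n np; rewrite zn ltxx.
by move: le0; rewrite E; nra.
Qed.

Lemma corner_seqs (q1 q2 : nat) e1 e2 : D = e1 ++ [:: q1, p, q2 & e2] ->
  (0 < q1 < p)%N -> (0 < q2 < p)%N ->
  exists w1 w2 x : int -> R,
  [/\ [/\ affrec w1, w1 0 = 0, w1 q1%:Z = 0 & forall n : int, 0 < n < p%:Z -> 0 <= w1 n],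
      [/\ affrec w2, w2 0 = 0, w2 q2%:Z = 0 & forall n : int, 0 < n < p%:Z -> 0 <= w2 n],
      [/\ affrec x, x 0 = 0 & forall n : int, 0 < n < p%:Z -> 0 < x n] &
      0 < fund q1%:Z /\ fund q2%:Z < 0].
Proof.
move=> De q1p q2p.
have sz : (size e1 + 2 < size D)%N by rewrite De size_cat /=; lia.
have n0 : nth 0%N D (size e1) = q1 by rewrite De nth_cat ltnn subnn.
have n1 : nth 0%N D (size e1).+1 = p.
  by rewrite De nth_cat ltnNge leqnSn /= subSnn.
have n2 : nth 0%N D (size e1).+2 = q2.
  by rewrite De nth_cat ltnNge -addn2 leq_addr /= addKn.
have ne (q : nat) : (0 < q)%N -> q \in D -> exists s, I_ tauL t d q s.
  by move=> q0 qD; apply/(nonempty_mem q q0).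
have [||s1 I1] := ne q1; [lia|by rewrite De mem_cat !inE eqxx !orbT|].
have [||s Is] := ne p; [lia|by rewrite De mem_cat !inE eqxx !orbT|].
have [||s2 I2] := ne q2; [lia|by rewrite De mem_cat !inE eqxx !orbT|].
have lt1 : s1 < s.
  by apply: (ordered (size e1) (size e1).+1); rewrite ?n0 ?n1 //; lia.
have lt2 : s < s2.
  by apply: (ordered (size e1).+1 (size e1).+2); rewrite ?n2 ?n1 //; lia.
have [|w1 hw1] := corner_seq q1 s s1 q1p Is I1.
  move=> e /andP[e0 e1'].
  have := between (size e1) s1 s (s + e * (s1 - s)); rewrite n0 n1.
  by case=> //; [lia|apply/andP; split; nra|right|left].
have [|w2 hw2] := corner_seq q2 s s2 q2p Is I2.
  move=> e /andP[e0 e1'].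
  have := between (size e1).+1 s s2 (s + e * (s2 - s)); rewrite n1 n2.
  by case=> //; [lia|apply/andP; split; nra|left|right].
have [spos _] := is_N_axis _ _ _ Is.2.
exists w1, w2, (axis s); split=> //.
  by split; [exact: affrec_axis|exact: axis0|].
(* Term [q1] rises from nonpositive to positive between [s1] and [s], and term [q2] falls between
   [s] and [s2]; this fixes the signs of [fund]. *)
have [_ l1] := is_N_axis _ _ _ I1.2; have [_ l2] := is_N_axis _ _ _ I2.2.
have p1 : 0 < axis s q1%:Z by apply: spos; lia.
have p2 : 0 < axis s q2%:Z by apply: spos; lia.
have := axis_fund s1 s q1%:Z; have := axis_fund s s2 q2%:Z.
by move=> h2 h1; split; nra.
Qed.

End Rotation.
End Recurrence.

Theorem proposition5p1 (R : realType) (tauL tauR deltaR : R) (m p : nat)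
    (hdelta1 : 1 < deltaR) (hdelta2 : tauR ^+ 2 / 4 < deltaR)
    (hrot : is_rotation_number tauL tauR deltaR m p) :
  (exists (v : 'I_p -> R * R) (T : 'I_p -> set (R * R)),
     [/\ open_polygon v (G tauR deltaR),
         clockwise v,
         forall j : 'I_p, T j `<=` Sigma tauR deltaR j
       & forall i : 'I_p, edge v i = T (rotation_perm m i)])
  /\ G tauR deltaR = iter p.-1 (fR tauR deltaR) @` F tauR deltaR p.
Proof.
have [/andP[p_gt0 cop] [nstar [D [hstar /andP[f0 f1] hD hmem [hcov hord]]]]] := hrot.
have frac_gt0 : 0 < Defs.frac m p.
  by apply: lt_le_trans f0; rewrite /Defs.frac mul1r invr_gt0 ltr0n.
have [|q1 [q2 [e1 [e2 [De /andP[q1_gt0 q2_gt0] q12 mq1 D_le]]]]] :=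
  is_D_parents _ _ _ _ hD; first by rewrite frac_gt0.
have q1p : (0 < q1 < p)%N by lia.
have q2p : (0 < q2 < p)%N by lia.
have norun := no_long_axis_run _ _ hdelta1 hdelta2 _ _ _ _ hstar hmem hcov D_le.
have [w1 [w2 [x [[hw1 w10 w1q w1pos] [hw2 w20 w2q w2pos] [hx x0 xpos] [fq1 fq2]]]]] :=
  corner_seqs _ _ hdelta1 hdelta2 _ _ _ hmem hcov hord _ _ _ _ De q1p q2p.
have [z [hz z0 zpos]] :=
  pinned_seq _ _ hdelta1 hdelta2 _ norun _ _ _ hx hw1 x0 w10 w1q q1p xpos w1pos.
by apply: (backward_polygon _ _ hdelta1 hdelta2 _ norun z hz z0 zpos
  q1 q2 _ _ _ w1 _ _ _ _ w2).
Qed.
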